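(* Let $A$ be a set, let the free group $F_A$ have a semi-saturated partial action $\theta$ on a compact Hausdorff totally disconnected space $X$, and let $\mathcal G=F_A\ltimes X$. Then there is a projective resolution of left $\mathbb Z\mathcal G$-modules \[0\longrightarrow \bigoplus_{a\in A}\mathbb Z\mathcal G1_{X_a}\xrightarrow{\ \partial\ } \mathbb Z\mathcal G\xrightarrow{\ r_\ast\ }\mathbb ZX\longrightarrow 0\] of the trivial module $\mathbb ZX$, where $\partial$ is defined on the $a$-component by $\partial(f)=f\delta_a-f$, with $\delta_a$ the characteristic function of $\{a\}\times X_{a^{-1}}$.
   Context: Partial actions: a partial action $\theta$ of a group $G$ on a locally compact Hausdorff totally disconnected space $X$ consists of, for each $g\in G$, a clopen subset $X_g\subseteq X$ and a homeomorphism $\theta_g\colon X_{g^{-1}}\to X_g$ such that $X_1=X$, $\theta_1=\mathrm{id}_X$, $\theta_g^{-1}=\theta_{g^{-1}}$, and whenever $\theta_g(\theta_h(x))$ is defined, $\theta_{gh}(x)$ is defined and equals it. $F_A$ is the free group on the set $A$ and $|w|$ is the length of the reduced word for $w\in F_A$. A partial action of $F_A$ is semi-saturated if $\theta_{uv}=\theta_u\circ\theta_v$ (equality of partial maps, including domains) whenever $|uv|=|u|+|v|$. Groupoid: $G\ltimes X$ has object space $X$ and arrow space $\{(g,x)\mid x\in X_{g^{-1}}\}\subseteq G\times X$ (subspace topology of the product topology, $G$ discrete), with $s(g,x)=x$, $r(g,x)=\theta_g(x)$, $(g,\theta_h(x))(h,x)=(gh,x)$, $(g,x)^{-1}=(g^{-1},\theta_g(x))$;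 the identities are the $(1,x)$, and $X$ is identified with the unit space via $x\mapsto(1,x)$. Algebra and trivial module: for a locally compact Hausdorff totally disconnected space $Y$, $\mathbb ZY$ is the abelian group of compactly supported locally constant functions $Y\to\mathbb Z$. $\mathbb Z\mathcal G$ is a ring under convolution $(f\ast g)(\gamma)=\sum_{r(\alpha)=r(\gamma)}f(\alpha)g(\alpha^{-1}\gamma)$, written as juxtaposition. The trivial left $\mathbb Z\mathcal G$-module is $\mathbb Z\mathcal G^0=\mathbb ZX$ with $(f\cdot g)(x)=\sum_{r(\gamma)=x}f(\gamma)g(s(\gamma))$. The map $r_\ast\colon\mathbb Z\mathcal G\to\mathbb ZX$ is $r_\ast(f)(x)=\sum_{r(\gamma)=x}f(\gamma)$. $1_{X_a}\in\mathbb Z\mathcal G$ is the characteristic function of $\{1\}\times X_a$. *)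

(* Defs.v *)
From HB Require Import structures.
From mathcomp Require Import all_boot all_order all_algebra.
From mathcomp Require Import finmap all_classical topology.

Set Implicit Arguments.
Unset Strict Implicit.
Unset Printing Implicit Defensive.

Import GRing.Theory.

Local Open Scope classical_set_scope.
Local Open Scope ring_scope.

(* The free group on A is realised on reduced words; the letter (a, true)
   stands for the generator a and (a, false) for its inverse. *)
Section FreeGroup.
Context {A : choiceType}.
Implicit Types (x y : A * bool) (s t : seq (A * bool)).

Definition letter_inv x : A * bool := (x.1, ~~ x.2).

Definition reduced s : bool := sorted (fun x y => y != letter_inv x) s.

Definition cons_reduce x s : seq (A * bool) :=
  if s is y :: s' then if y == letter_inv x then s' else x :: s else [:: x].

Lemma letter_invK : involutive letter_inv.
Proof. by case=> a b; rewrite /letter_inv /= negbK. Qed.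

Lemma cons_reduce_reduced x s : reduced s -> reduced (cons_reduce x s).
Proof.
case: s => [|y s] //= ps; case: ifPn => [_|yx]; first exact: path_sorted ps.
by rewrite /reduced /= yx.
Qed.

Lemma cons_reduceK x s : reduced s -> cons_reduce (letter_inv x) (cons_reduce x s) = s.
Proof.
case: s => [|y s] //=; first by rewrite letter_invK eqxx.
rewrite /reduced /=; case: eqVneq => [-> |yx] ps /=; last by rewrite letter_invK eqxx.
by case: s ps => [|z s] //= /andP[/negbTE ->].
Qed.

Lemma foldr_reduced s t : reduced t -> reduced (foldr cons_reduce t s).
Proof. by move=> rt; elim: s => //= x s IHs; apply: cons_reduce_reduced. Qed.

Lemma foldr_cons_reduce x s t : reduced s -> reduced t ->
  foldr cons_reduce t (cons_reduce x s) = cons_reduce x (foldr cons_reduce t s).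
Proof.
case: s => [|y s] //= ps rt; case: ifPn => [/eqP-> |//].
have := cons_reduceK (letter_inv x) (foldr_reduced s rt).
by rewrite letter_invK.
Qed.

Lemma foldr_cat_reduced s t r : reduced t -> reduced r ->
  foldr cons_reduce r (foldr cons_reduce t s) =
  foldr cons_reduce (foldr cons_reduce r t) s.
Proof.
move=> rt rr; elim: s => //= x s IHs.
by rewrite foldr_cons_reduce ?IHs //; apply: foldr_reduced.
Qed.

Lemma foldr_reduced_nil s : reduced s -> foldr cons_reduce [::] s = s.
Proof.
elim: s => //= x s IHs ps; rewrite IHs; last exact: path_sorted ps.
by case: s ps {IHs} => //= y s /andP[/negbTE ->].
Qed.

Definition word_inv s := rev (map letter_inv s).

Lemma word_inv_reduced s : reduced s -> reduced (word_inv s).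
Proof.
rewrite /reduced /word_inv rev_sorted sorted_map.
apply: sub_sorted => x y /=; apply: contra => /eqP ->.
by rewrite !letter_invK.
Qed.

Lemma foldr_word_inv s t : reduced t ->
  foldr cons_reduce (foldr cons_reduce t s) (word_inv s) = t.
Proof.
move=> rt; elim: s => //= x s IHs.
rewrite /word_inv /= rev_cons foldr_rcons cons_reduceK //.
exact: foldr_reduced.
Qed.

End FreeGroup.

Record free_group (A : choiceType) :=
  FreeGroup { word : seq (A * bool); _ : reduced word }.

HB.instance Definition _ A := [isSub for @word A].
HB.instance Definition _ A := [Choice of free_group A by <:].

Section FreeGroupLaws.
Variable A : choiceType.
Implicit Types u v w : free_group A.

Definition fg_one : free_group A := @FreeGroup A [::] isT.
Definition fg_inv u : free_group A :=
  FreeGroup (word_inv_reduced (valP u)).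
Definition fg_mul u v : free_group A :=
  FreeGroup (foldr_reduced (word u) (valP v)).

Fact fg_mulA : associative fg_mul.
Proof.
by move=> u v w; apply/val_inj; rewrite /= foldr_cat_reduced //; exact: valP.
Qed.
Fact fg_mul1 : left_id fg_one fg_mul.
Proof. by move=> u; apply/val_inj. Qed.
Fact fg_mulr1 : right_id fg_one fg_mul.
Proof. by move=> u; apply/val_inj; rewrite /= foldr_reduced_nil //; exact: valP. Qed.
Fact fg_mulV : left_inverse fg_one fg_inv fg_mul.
Proof.
move=> u; apply/val_inj => /=.
by rewrite -{1}(foldr_reduced_nil (valP u)) foldr_word_inv.
Qed.
Fact fg_invK : involutive fg_inv.
Proof.
move=> u; apply/val_inj; rewrite /= /word_inv map_rev revK -map_comp.
by rewrite map_id_in // => x _ /=; rewrite letter_invK.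
Qed.
Fact fg_mulVr : right_inverse fg_one fg_inv fg_mul.
Proof. by move=> u; rewrite -{1}(fg_invK u) fg_mulV. Qed.

HB.instance Definition _ :=
  isGroup.Build (free_group A) fg_mulA fg_mul1 fg_mulr1 fg_mulV fg_mulVr.

Definition free_gen (a : A) : free_group A := @FreeGroup A [:: (a, true)] isT.

End FreeGroupLaws.

Definition locally_constant (Y : topologicalType) (T : Type) (f : Y -> T) :=
  forall y, \forall z \near y, f z = f y.

Definition zfun_pred (Y : topologicalType) : {pred Y -> int} := fun f =>
  `[< locally_constant f /\ compact (closure [set y | f y != 0]) >].

Fact zfun_zmod_closed (Y : topologicalType) : zmod_closed (@zfun_pred Y).
Proof.
split=> [|f g /asboolP[fl fc] /asboolP[gl gc]]; apply/asboolP; split.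
- by move=> y; apply: nearW.
- rewrite (_ : [set _ | _] = set0) ?closure0; first exact: compact0.
  by apply/seteqP; split=> y //=; rewrite eqxx.
- move=> y; near=> z; rewrite !fctE; congr (_ - _); near: z; [exact: fl|exact: gl].
- apply: subclosed_compact (compactU fc gc) _; first exact: closed_closure.
  rewrite -closureU; apply: closure_subset => y /=.
  rewrite !fctE; case: (eqVneq (f y) 0) => [->|]; last by left.
  by rewrite sub0r oppr_eq0; right.
Unshelve. all: by end_near. Qed.

HB.instance Definition _ (Y : topologicalType) :=
  GRing.isZmodClosed.Build (Y -> int) (@zfun_pred Y) (@zfun_zmod_closed Y).

Record zfun (Y : topologicalType) :=
  ZFun { zfun_val :> Y -> int; zfun_valP : zfun_val \in @zfun_pred Y }.

HB.instance Definition _ Y := [isSub for @zfun_val Y].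
HB.instance Definition _ Y := [Choice of zfun Y by <:].
HB.instance Definition _ Y := [SubChoice_isSubZmodule of zfun Y by <:].

Lemma clopen_indic_zfun (Y : topologicalType) (S : set Y) :
  clopen S -> compact S -> (fun y => (y \in S)%:R : int) \in @zfun_pred Y.
Proof.
move=> [oS cS] kS; apply/asboolP; split.
  move=> y; have [Sy|Sy] := pselect (S y).
    near=> z; rewrite (mem_set Sy); suff /mem_set -> : S z by [].
    by near: z; exact: open_nbhs_nbhs.
  near=> z; rewrite (memNset Sy); suff Sz : ~ S z by rewrite (memNset Sz).
  by near: z; apply: open_nbhs_nbhs; split=> //; exact: closed_openC.
rewrite (_ : [set _ | _] = S); first by rewrite -(closure_id S).1.
apply/seteqP; split=> y /=; first by have [/set_mem|] := boolP (y \in S).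
by move=> /mem_set ->.
Unshelve. all: by end_near. Qed.

Definition zindic (Y : topologicalType) (S : set Y) (oS : clopen S)
  (kS : compact S) : zfun Y := ZFun (clopen_indic_zfun oS kS).

(* [pdom g] is X_g and [pact g] represents theta_g : X_{g^-1} -> X_g.  The
   function [pact g] is total, but its values outside X_{g^-1} carry no meaning. *)
Record partial_action (G : groupType) (X : topologicalType) := PartialAction {
  pdom : G -> set X;
  pact :> G -> X -> X;
  pdom_clopen : forall g, clopen (pdom g);
  pact_dom : forall g x, pdom g^-1%g x -> pdom g (pact g x);
  pact_continuous : forall g, {within pdom g^-1%g, continuous (pact g)};
  pdom1 : pdom 1%g = setT;
  pact1 : forall x, pact 1%g x = x;
  pactK : forall g x, pdom g^-1%g x -> pact g^-1%g (pact g x) = x;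
  pactM : forall g h x, pdom h^-1%g x -> pdom g^-1%g (pact h x) ->
    pdom (g * h)^-1%g x /\ pact (g * h)%g x = pact g (pact h x)
}.

Section Groupoid.
Context {G : groupType} {X : topologicalType} (th : partial_action G X).

Definition arrow_set : set (discrete_topology G * X) :=
  [set p | pdom th (p.1 : G)^-1%g p.2].

Definition arrow : topologicalType := set_type arrow_set.

Definition lab (c : arrow) : G := (val c).1.
Definition src (c : arrow) : X := (val c).2.
Definition rng (c : arrow) : X := th (lab c) (src c).

Lemma arrowP (c : arrow) : pdom th (lab c)^-1%g (src c).
Proof. exact: set_mem (valP c). Qed.

Lemma rng_dom (c : arrow) : pdom th (lab c) (rng c).
Proof. by apply: pact_dom; exact: arrowP. Qed.

Definition mkarrow (g : G) (x : X) (gx : pdom th g^-1%g x) : arrow :=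
  exist _ ((g, x) : discrete_topology G * X) (mem_set (gx : arrow_set (g, x))).

Lemma rng_domV (c : arrow) : pdom th (lab c)^-1^-1%g (rng c).
Proof. by rewrite invgK; apply: rng_dom. Qed.
Definition inv_arrow (c : arrow) : arrow := mkarrow (rng_domV c).

(* Meaningful only when [src c = rng d], see [mul_arrowE]; otherwise the
   default value [d] is returned. *)
Definition mul_arrow (c d : arrow) : arrow :=
  insubd d ((lab c * lab d)%g, src d).

Lemma mul_arrowE c d : src c = rng d ->
  [/\ lab (mul_arrow c d) = (lab c * lab d)%g, src (mul_arrow c d) = src d &
      rng (mul_arrow c d) = rng c].
Proof.
move=> cd; have [dom eq] : pdom th (lab c * lab d)^-1%g (src d) /\
    th (lab c * lab d)%g (src d) = th (lab c) (th (lab d) (src d)).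
  by apply: pactM; [exact: arrowP | rewrite -/(rng d) -cd; exact: arrowP].
have ein : (((lab c * lab d)%g, src d) : discrete_topology G * X) \in arrow_set.
  exact: mem_set.
have E : val (mul_arrow c d) = ((lab c * lab d)%g, src d).
  by rewrite /mul_arrow val_insubd ein.
have El : lab (mul_arrow c d) = (lab c * lab d)%g by rewrite /lab E.
have Es : src (mul_arrow c d) = src d by rewrite /src E.
by split=> //; rewrite /rng El Es eq -/(rng d) -cd.
Qed.

(* [\sum_(i \in D) F i] is the sum over the i in D with F i <> 0 (by convention
   0 if there are infinitely many of them).  For f in ZG only finitely many
   terms below are nonzero, by [gsupp_finite] and [fiber_sum]. *)
Definition conv (f h : arrow -> int) (c : arrow) : int :=
  \sum_(d \in [set d | rng d = rng c]) f d * h (mul_arrow (inv_arrow d) c).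

Definition act_triv (f : arrow -> int) (p : X -> int) (x : X) : int :=
  \sum_(c \in [set c | rng c = x]) f c * p (src c).

Definition rng_push (f : arrow -> int) (x : X) : int :=
  \sum_(c \in [set c | rng c = x]) f c.

(* {g} x U, restricted to the arrows of the groupoid. *)
Definition slice (g : G) (U : set X) : set arrow :=
  [set c | lab c = g /\ U (src c)].

End Groupoid.

Arguments slice {G X} th g U.

Section ConvolutionFacts.
Context {G : groupType} {X : topologicalType} {th : partial_action G X}.
Implicit Types (g h k : G) (x y : X) (c d : arrow th) (f : arrow th -> int).

Fact pactVK g y : pdom th g y -> th g (th g^-1%g y) = y.
Proof. by move=> gy; have := @pactK _ _ th g^-1%g y; rewrite invgK; apply. Qed.

Fact pactV_dom g y : pdom th g y -> pdom th g^-1%g (th g^-1%g y).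
Proof. by move=> gy; apply: pact_dom; rewrite invgK. Qed.

Definition arrow_at g y (gy : pdom th g y) : arrow th := mkarrow (pactV_dom gy).

Fact rng_arrow_at g y (gy : pdom th g y) : rng (arrow_at gy) = y.
Proof. exact: pactVK. Qed.

Fact src_rng c : src c = th (lab c)^-1%g (rng c).
Proof. by rewrite /rng pactK //; exact: arrowP. Qed.

Fact arrow_eq c d : lab c = lab d -> src c = src d -> c = d.
Proof.
rewrite /lab /src => l s; apply/val_inj.
by case: (val c) (val d) l s => [? ?] [? ?] /= -> ->.
Qed.

Fact arrow_at_lab_rng c (gy : pdom th (lab c) (rng c)) : arrow_at gy = c.
Proof. by apply: arrow_eq => //; rewrite [RHS]src_rng. Qed.

(* The value of f at the unique arrow with label g and range y, extended by 0. *)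
Definition coef f g y : int :=
  if pselect (pdom th g y) is left gy then f (arrow_at gy) else 0.

Fact coefE f c : coef f (lab c) (rng c) = f c.
Proof.
rewrite /coef; case: pselect => [gy|]; first by rewrite arrow_at_lab_rng.
by move=> /(_ (rng_dom c)).
Qed.

Fact coef_out f g y : ~ pdom th g y -> coef f g y = 0.
Proof. by rewrite /coef; case: pselect. Qed.

Fact coef_neq0 f g y : coef f g y != 0 -> pdom th g y.
Proof. by move=> /eqP f0; apply: contrapT => /(coef_out f). Qed.

Fact coef_ext f f' : (forall g y, coef f g y = coef f' g y) -> f = f'.
Proof. by move=> ff'; apply/funext => c; rewrite -!coefE ff'. Qed.

Fact coefB f f' g y : coef (f - f') g y = coef f g y - coef f' g y.
Proof. by rewrite /coef; case: pselect => // _; rewrite subr0. Qed.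

Fact coefD f f' g y : coef (f + f') g y = coef f g y + coef f' g y.
Proof. by rewrite /coef; case: pselect => // _; rewrite addr0. Qed.

Fact fiber_sum f y (K : G -> int) :
  \sum_(c \in [set c | rng c = y]) f c * K (lab c) =
  \sum_(g \in setT) coef f g y * K g.
Proof.
transitivity (\sum_(g \in [set g | pdom th g y]) coef f g y * K g).
  rewrite (reindex_fsbig (@lab _ _ th) [set c | rng c = y]).
    by apply: eq_fsbigr => c /set_mem /= <-; rewrite coefE.
  split.
  - by move=> c /= <-; exact: rng_dom.
  - move=> c d /set_mem /= cy /set_mem /= dy cd; apply: arrow_eq => //.
    by rewrite !src_rng cd cy dy.
  - by move=> g gy; exists (arrow_at gy) => //=; exact: rng_arrow_at.
apply: fsbig_widen => // g [_ /= gy].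
by rewrite coef_out // mul0r.
Qed.

Definition gsupp f : set G := [set g | exists y, coef f g y != 0].

Fact coef0_gsupp f g y : ~ gsupp f g -> coef f g y = 0.
Proof. by move=> fg; apply/eqP/negP => /negP f0; apply: fg; exists y. Qed.

Fact gsum_finite f (D : set G) y (K : G -> int) : finite_set D -> gsupp f `<=` D ->
  \sum_(g \in setT) coef f g y * K g =
  \sum_(g <- fset_set D) coef f g y * K g.
Proof.
move=> fD fsD; rewrite -fsbig_finite //.
apply/esym/fsbig_widen => // g [_ /= Dg].
by rewrite (coef0_gsupp y (contra_not (@fsD g) Dg)) mul0r.
Qed.

Fact pdomM_coef g k y : pdom th g y -> pdom th (g^-1 * k)%g (th g^-1%g y) ->
  pdom th k y /\ th (k^-1)%g y = th (g^-1 * k)^-1%g (th g^-1%g y).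
Proof.
move=> gy gky; have := @pactM _ _ th (k^-1 * g)%g g^-1%g y.
by rewrite mulgK !invgK !invgM !invgK; apply.
Qed.

Fact coef_conv f f' k y : coef (conv f f') k y =
  \sum_(g \in setT) coef f g y * coef f' (g^-1 * k)%g (th g^-1%g y).
Proof.
have [ky|ky] := pselect (pdom th k y); last first.
  rewrite coef_out // fsbig1 // => g _.
  have [->|/coef_neq0 gy] := eqVneq (coef f g y) 0; first by rewrite mul0r.
  rewrite [X in _ * X]coef_out ?mulr0 // => gky; apply: ky.
  by have [] := pdomM_coef gy gky.
rewrite -(fiber_sum _ _ (fun g => coef f' (g^-1 * k)%g (th g^-1%g y))).
rewrite /coef; case: pselect => // {}ky; rewrite /conv rng_arrow_at.
apply: eq_fsbigr => c /set_mem /= cy; congr (_ * _).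
have [|El Es Er] := @mul_arrowE _ _ th (inv_arrow c) (arrow_at ky).
  by rewrite rng_arrow_at.
rewrite -coefE El Er; congr (coef _ _ _).
by rewrite [LHS](_ : _ = th (lab c)^-1%g (rng c)) // cy.
Qed.

Fact act_trivE f (p : X -> int) x : act_triv f p x =
  \sum_(g \in setT) coef f g x * p (th g^-1%g x).
Proof.
rewrite -(fiber_sum _ _ (fun g => p (th g^-1%g x))).
by apply: eq_fsbigr => c /set_mem /= <-; rewrite src_rng.
Qed.

Fact rng_pushE f x : rng_push f x = \sum_(g \in setT) coef f g x * 1.
Proof.
rewrite -(fiber_sum _ _ (fun=> 1)).
by apply: eq_fsbigr => c _; rewrite mulr1.
Qed.

Fact gsupp_conv f f' : gsupp (conv f f') `<=`
  [set (g * k)%g | g in gsupp f & k in gsupp f'].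
Proof.
move=> b [y]; rewrite coef_conv => s0.
have [g [fg f'g]] : exists g, coef f g y != 0 /\
    coef f' (g^-1 * b)%g (th g^-1%g y) != 0.
  apply: contrapT => ne; move/eqP: s0; apply; apply: fsbig1 => g _.
  apply/eqP; rewrite mulf_eq0; apply/negP => /negP.
  by rewrite negb_or => /andP[? ?]; apply: ne; exists g.
exists g; first by exists y.
exists (g^-1 * b)%g; first by exists (th g^-1%g y).
by rewrite mulVKg.
Qed.

Fact finite_gsupp_conv f f' : finite_set (gsupp f) -> finite_set (gsupp f') ->
  finite_set (gsupp (conv f f')).
Proof.
move=> ff ff'; apply: sub_finite_set (gsupp_conv (f:=f) (f':=f')) _.
exact: finite_image2.
Qed.

Fact conv_sum f f' (q : G -> X -> int) y :
  finite_set (gsupp f) -> finite_set (gsupp f') ->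
  \sum_(b \in setT) coef (conv f f') b y * q b (th b^-1%g y) =
  \sum_(a \in setT) coef f a y * \sum_(k \in setT) coef f' k (th a^-1%g y) *
     q (a * k)%g (th k^-1%g (th a^-1%g y)).
Proof.
move=> ff ff'; set T := [set (g * k)%g | g in gsupp f & k in gsupp f'].
have fT : finite_set T by exact: finite_image2.
rewrite (gsum_finite _ _ fT); last exact: gsupp_conv.
rewrite [RHS](@gsum_finite f (gsupp f)) //.
under eq_bigr => b _ do
  rewrite coef_conv (@gsum_finite f (gsupp f)) // mulr_suml.
rewrite exchange_big /=; apply: eq_big_seq => a; rewrite in_fset_set // => /set_mem fa.
under eq_bigr => b _ do rewrite -mulrA.
rewrite -mulr_sumr; have [->|/coef_neq0 ay] := eqVneq (coef f a y) 0.
  by rewrite !mul0r.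
congr (_ * _); rewrite -fsbig_finite //.
rewrite (fsbig_widen T setT) //; last first.
  move=> b [_ /= Tb]; rewrite (@coef0_gsupp f') ?mul0r // => f'b; apply: Tb.
  by exists a => //; exists (a^-1 * b)%g => //; rewrite mulVKg.
rewrite (reindex_fsbigT (fun k => (a * k)%g)); last first.
  by exists (fun k => (a^-1 * k)%g) => k; rewrite ?mulKg ?mulVKg.
apply: eq_fsbigr => k _; rewrite mulKg.
have [->|/coef_neq0 kay] := eqVneq (coef f' k (th a^-1%g y)) 0.
  by rewrite !mul0r.
congr (_ * q _ _).
have [] := @pdomM_coef a (a * k)%g y ay; first by rewrite mulKg.
by rewrite mulKg.
Qed.

Fact convA f1 f2 f3 : finite_set (gsupp f1) -> finite_set (gsupp f2) ->
  conv f1 (conv f2 f3) = conv (conv f1 f2) f3.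
Proof.
move=> fin1 fin2; apply: coef_ext => k y.
rewrite !coef_conv.
rewrite (conv_sum (fun b z => coef f3 (b^-1 * k)%g z)) //.
apply: eq_fsbigr => a _; congr (_ * _); rewrite coef_conv.
by apply: eq_fsbigr => b _; rewrite invgM mulgA.
Qed.

Fact act_trivA f f' p : finite_set (gsupp f) -> finite_set (gsupp f') ->
  act_triv f (act_triv f' p) = act_triv (conv f f') p.
Proof.
move=> ff ff'; apply/funext => x; rewrite !act_trivE.
rewrite (conv_sum (fun=> p)) //.
by apply: eq_fsbigr => a _; rewrite act_trivE.
Qed.

Fact gsuppD f f' : gsupp (f + f') `<=` gsupp f `|` gsupp f'.
Proof.
move=> g [y]; rewrite coefD; case: (eqVneq (coef f g y) 0) => [->|f0].
  by rewrite add0r; right; exists y.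
by left; exists y.
Qed.

Fact gsumD f f' y K : finite_set (gsupp f) -> finite_set (gsupp f') ->
  \sum_(g \in setT) coef (f + f') g y * K g =
  \sum_(g \in setT) coef f g y * K g + \sum_(g \in setT) coef f' g y * K g.
Proof.
move=> ff ff'; have fT : finite_set (gsupp f `|` gsupp f') by rewrite finite_setU.
rewrite (gsum_finite _ _ fT (@gsuppD f f')).
rewrite (gsum_finite _ _ fT (@subsetUl _ _ _)) (gsum_finite _ _ fT (@subsetUr _ _ _)).
by rewrite -big_split; apply: eq_bigr => g _; rewrite /= coefD mulrDl.
Qed.

Fact gsumDr f y K L : finite_set (gsupp f) ->
  \sum_(g \in setT) coef f g y * (K g + L g) =
  \sum_(g \in setT) coef f g y * K g + \sum_(g \in setT) coef f g y * L g.
Proof.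
move=> ff; rewrite !(@gsum_finite f (gsupp f)) //.
by rewrite -big_split; apply: eq_bigr => g _; rewrite /= mulrDr.
Qed.

Fact convDl f f' f3 : finite_set (gsupp f) -> finite_set (gsupp f') ->
  conv (f + f') f3 = conv f f3 + conv f' f3.
Proof. by move=> *; apply: coef_ext => k y; rewrite coefD !coef_conv gsumD. Qed.

Fact convDr f f2 f3 : finite_set (gsupp f) ->
  conv f (f2 + f3) = conv f f2 + conv f f3.
Proof.
move=> *; apply: coef_ext => k y; rewrite coefD !coef_conv -gsumDr //.
by apply: eq_fsbigr => g _; rewrite coefD.
Qed.

Fact act_trivDl f f' p : finite_set (gsupp f) -> finite_set (gsupp f') ->
  act_triv (f + f') p = act_triv f p + act_triv f' p.
Proof. by move=> ff ff'; apply/funext => y; rewrite act_trivE gsumD // -!act_trivE. Qed.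

Fact act_trivDr f p q : finite_set (gsupp f) ->
  act_triv f (p + q) = act_triv f p + act_triv f q.
Proof. by move=> ff; apply/funext => y; rewrite [RHS]/GRing.add /= !act_trivE -gsumDr. Qed.

Definition uchar c : int := (c \in slice th 1%g setT)%:R.

Fact coef_uchar g y : coef uchar g y = (g == 1%g)%:R.
Proof.
rewrite /coef; case: pselect => [gy|].
  rewrite /uchar; congr ((_ : bool)%:R); apply/idP/eqP.
    by move=> /set_mem [].
  by move=> g1; apply/mem_set; split.
by case: eqP => // ->; rewrite pdom1 => /(_ I).
Qed.

Fact gsum_uchar y K : \sum_(g \in setT) coef uchar g y * K g = K 1%g.
Proof.
rewrite -(fsbig_widen [set 1%g]) //; last first.
  by move=> g [_ /= g1]; rewrite coef_uchar; move/eqP/negbTE: g1 => ->; rewrite mul0r.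
by rewrite fsbig_set1 coef_uchar eqxx mul1r.
Qed.

Fact conv1f f : conv uchar f = f.
Proof.
apply: coef_ext => k y.
by rewrite coef_conv (gsum_uchar _ (fun g => _)) invg1 mul1g pact1.
Qed.

Fact convf1 f : conv f uchar = f.
Proof.
apply: coef_ext => k y; rewrite coef_conv.
rewrite -(fsbig_widen [set k]) //; last first.
  move=> g [_ /= gk]; rewrite coef_uchar; case: eqP; rewrite ?mulr0 //.
  by move=> /(congr1 (fun h => (g * h)%g)); rewrite mulVKg mulg1 => kg; case: gk.
by rewrite fsbig_set1 mulVg coef_uchar eqxx mulr1.
Qed.

Fact act_triv1 p : act_triv uchar p = p.
Proof.
apply/funext => x; rewrite act_trivE (gsum_uchar _ (fun g => _)).
by rewrite invg1 pact1.
Qed.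

Fact nbhs_arrow c (A : set (arrow th)) : nbhs c A <->
  exists2 U, nbhs (src c) U & forall d, lab d = lab c -> U (src d) -> A d.
Proof.
split.
  rewrite nbhsE => -[_ [[V oV <-] Vc] VA].
  have /= [[P Q] /= [Pc Qc] PQ] := open_nbhs_nbhs (conj oV Vc).
  exists Q => // d lcd Qd; apply: VA => /=; apply: (PQ (val d)); split=> //=.
  by have := nbhs_singleton Pc; rewrite -/(lab d) lcd.
move=> [U Uc UA].
have H : nbhs (val c) [set p | p.1 = lab c /\ U p.2].
  exists ([set lab c], U) => /=; first by split=> //; exact: discrete_set1.
  by move=> p /=.
have {}H : nbhs c (val @^-1` [set p : discrete_topology G * X | p.1 = lab c /\ U p.2]).
  exact: (@initial_continuous _ _ (set_val : arrow th -> _) c _ H).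
by apply: filterS H => d [] /=; exact: UA.
Qed.

Fact pact_cvg g x (A : set X) : pdom th g^-1%g x -> nbhs (th g x) A ->
  nbhs x (fun z => pdom th g^-1%g z /\ A (th g z)).
Proof.
move=> gx nA; have [od _] := pdom_clopen th g^-1%g.
apply: filterI; first exact: open_nbhs_nbhs.
have := @pact_continuous _ _ th g.
rewrite continuous_open_subspace // => /(_ x); rewrite inE => /(_ gx); exact.
Qed.

Fact pactV_cvg g y (A : set X) : pdom th g y -> nbhs (th g^-1%g y) A ->
  nbhs y (fun z => pdom th g z /\ A (th g^-1%g z)).
Proof. by move=> gy nA; have := @pact_cvg g^-1%g y A; rewrite invgK; apply. Qed.

Fact notpdom_nbhs g y : ~ pdom th g y -> nbhs y (~` pdom th g).
Proof.
by move=> gy; apply: open_nbhs_nbhs; split=> //; apply: closed_openC;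
  have [] := pdom_clopen th g.
Qed.

Fact coef_locally_constant f g : locally_constant f -> locally_constant (coef f g).
Proof.
move=> fl y; have [gy|gy] := pselect (pdom th g y); last first.
  by apply: filterS (notpdom_nbhs gy) => z gz; rewrite !coef_out.
have [U Uy UA] := (nbhs_arrow _ _).1 (fl (arrow_at gy)).
apply: filterS (pactV_cvg gy Uy) => z [gz Uz].
rewrite /coef; case: pselect => // {}gz; case: pselect => // gy'.
rewrite (Prop_irrelevance gy' gy); exact: UA.
Qed.

Fact locally_constant_coef f :
  (forall g, locally_constant (coef f g)) -> locally_constant f.
Proof.
move=> fl c; apply/nbhs_arrow.
have /= := pact_cvg (arrowP c) (fl (lab c) (rng c)).
move=> H; eexists; first exact: H.
by move=> d dc /= [_]; rewrite -dc => H1; rewrite -coefE H1 dc coefE.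
Qed.

Fact locally_constant_act f g (Q : X -> int) :
  locally_constant (coef f g) -> locally_constant Q ->
  locally_constant (fun y => coef f g y * Q (th g^-1%g y)).
Proof.
move=> fl Ql y; have [gy|gy] := pselect (pdom th g y); last first.
  by apply: filterS (notpdom_nbhs gy) => z gz; rewrite !coef_out ?mul0r.
have := pactV_cvg gy (Ql _); apply: filterS2 (fl y) => z -> [_ ->] //.
Qed.

Fact locally_constant_sum (I : Type) (r : seq I) (F : I -> X -> int) :
  (forall i, locally_constant (F i)) ->
  locally_constant (fun y => \sum_(i <- r) F i y).
Proof.
move=> Fl y; elim: r => [|i r IHr]; first by apply: nearW => z; rewrite !big_nil.
by apply: filterS2 (Fl i y) IHr => z; rewrite !big_cons => -> ->.
Qed.

Fact gsupp_finite (f : zfun (arrow th)) : finite_set (gsupp f).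
Proof.
have /asboolP[fl /compact_near_coveringP cov] := zfun_valP f.
pose F : set_system (set G) :=
  filter_from finite_set (fun D => [set E | D `<=` E]).
have FF : Filter F.
  apply: filter_from_filter; first by exists set0; exact: finite_set0.
  move=> D E fD fE; exists (D `|` E); first by rewrite finite_setU.
  by move=> H DEH; split=> g ?; apply: DEH; [left|right].
have [|D fD /(_ D (@subset_refl _ D)) /= KD] :=
    cov _ F (fun E c => E (lab c)) FF.
  move=> c _; exists ([set d | lab d = lab c], [set E | E (lab c)]) => /=.
    split; first by apply/nbhs_arrow; exists setT => //; exact: filterT.
    exists [set lab c]; first exact: finite_set1.
    by move=> E; exact.
  by move=> [d E] [/= dc Ec]; rewrite /= dc; exact: Ec.
apply: sub_finite_set fD.
move=> g [y]; rewrite /coef; case: pselect => [gy f0|]; last by rewrite eqxx.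
exact: (KD (arrow_at gy) (@subset_closure _ [set c | zfun_val f c != 0] _ f0)).
Qed.

Fact slice_clopen g U : clopen U -> clopen (slice th g U).
Proof.
have sub V h : open V -> open (slice th h V).
  move=> oV; rewrite openE => c [cg Vc]; apply/nbhs_arrow.
  by exists V; [exact: open_nbhs_nbhs | move=> d dc ?; split; rewrite ?dc].
move=> [oU cU]; split; first exact: sub.
rewrite -[slice _ _ _]setCK; apply: open_closedC.
rewrite (_ : ~` _ = (slice th g (~` U)) `|` \bigcup_(h in [set~ g]) slice th h setT).
  apply: openU; first by apply: sub; exact: closed_openC.
  by apply: bigcup_open => h _; apply: sub; exact: openT.
apply/seteqP; split=> c /=.
  move=> nc; have [cg|cg] := pselect (lab c = g); last by right; exists (lab c).
  by left; split=> // Uc; apply: nc; split.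
by move=> [[cg nU] [_ Uc]|[h hg [ch _]] [cg _]]; [exact: nU | case: hg; rewrite -ch].
Qed.

Hypothesis cX : compact [set: X].

Fact slice_compact g U : closed U -> compact (slice th g U).
Proof.
move=> cU; apply/compact_near_coveringP => I F P FF cov.
have [_ cd] := pdom_clopen th g^-1%g.
have : compact (U `&` pdom th g^-1%g).
  by apply: (subclosed_compact _ cX) => //; exact: closedI.
move=> /compact_near_coveringP /(_ I F
  (fun i x => forall c, lab c = g -> src c = x -> P i c) FF) H.
suff W : \forall i \near F, U `&` pdom th g^-1%g `<=`
    (fun x => forall c, lab c = g -> src c = x -> P i c).
  apply: filterS W => i Wi c [cg Uc].
  by apply: (Wi (src c)) => //; split=> //; rewrite -cg; exact: arrowP.
apply: H => x [Ux gx]; pose c := mkarrow gx.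
have [|[A B] /= [nA FB] AB] := cov c; first by split.
have [V Vx VA] := (nbhs_arrow _ _).1 nA.
exists (V, B) => //= -[z i] /= [Vz Bi] d dg dz.
by apply: (AB (d, i)); split=> //=; apply: VA; rewrite ?dg // dz.
Qed.

Fact zfun_arrowP f : (forall g, locally_constant (coef f g)) ->
  finite_set (gsupp f) -> f \in @zfun_pred (arrow th).
Proof.
move=> fl ff; apply/asboolP; split; first exact: locally_constant_coef.
apply: (@subclosed_compact _ _ (\big[setU/set0]_(g <- fset_set (gsupp f)) slice th g setT)).
- exact: closed_closure.
- rewrite big_seq; apply: (big_ind (@compact (arrow th))).
  + exact: compact0.
  + exact: compactU.
  + by move=> g _; apply: slice_compact; exact: closedT.
- set K := (X in _ `<=` X); suff cK : closed K.
    rewrite ((closure_id K).1 cK); apply: closure_subset => c /= fc.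
    rewrite /K -bigcup_fset_set //; exists (lab c) => //.
    by exists (rng c); rewrite coefE.
  rewrite /K -bigcup_fset_set //; apply: closed_bigcup => // g _.
  by have [] := slice_clopen g (@clopenT X).
Qed.

Fact zfun_XP (p : X -> int) : locally_constant p -> p \in @zfun_pred X.
Proof.
move=> pl; apply/asboolP; split=> //.
by apply: (subclosed_compact _ cX) => //; exact: closed_closure.
Qed.

Fact zfun_coef_lc (f : zfun (arrow th)) g : locally_constant (coef f g).
Proof. by apply: coef_locally_constant; have /asboolP[] := zfun_valP f. Qed.

Fact zfun_X_lc (p : zfun X) : locally_constant p.
Proof. by have /asboolP[] := zfun_valP p. Qed.

Fact conv_zfun (f h : zfun (arrow th)) : conv f h \in @zfun_pred (arrow th).
Proof.
apply: zfun_arrowP; last by apply: finite_gsupp_conv; exact: gsupp_finite.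
move=> k; rewrite (_ : coef _ k = fun y => \sum_(g <- fset_set (gsupp f))
    coef f g y * coef h (g^-1 * k)%g (th g^-1%g y)); last first.
  apply/funext => y; rewrite coef_conv (@gsum_finite f (gsupp f)) //.
  exact: gsupp_finite.
apply: locally_constant_sum => g; apply: locally_constant_act; exact: zfun_coef_lc.
Qed.

Fact act_triv_zfun (f : zfun (arrow th)) (p : X -> int) :
  locally_constant p -> act_triv f p \in @zfun_pred X.
Proof.
move=> pl; apply: zfun_XP.
rewrite (_ : act_triv f p = fun y => \sum_(g <- fset_set (gsupp f))
    coef f g y * p (th g^-1%g y)); last first.
  apply/funext => y; rewrite act_trivE (@gsum_finite f (gsupp f)) //.
  exact: gsupp_finite.
apply: locally_constant_sum => g; apply: locally_constant_act => //.
exact: zfun_coef_lc.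
Qed.

Fact rng_push_zfun (f : zfun (arrow th)) : rng_push f \in @zfun_pred X.
Proof.
rewrite (_ : rng_push f = act_triv f (fun=> 1)).
  by apply: act_triv_zfun => x; apply: nearW.
by apply/funext => x; rewrite rng_pushE act_trivE.
Qed.

End ConvolutionFacts.

(* ZG.  Compactness of X provides the unit of the ring. *)
Definition groupoid_ring (G : groupType) (X : topologicalType)
  (cX : compact [set: X]) (th : partial_action G X) : Type := zfun (arrow th).

Section GroupoidRing.
Context {G : groupType} {X : topologicalType}.
Variables (cX : compact [set: X]) (th : partial_action G X).
Implicit Types f h : groupoid_ring cX th.

HB.instance Definition _ := GRing.Zmodule.on (groupoid_ring cX th).

Definition slice_indic (g : G) (U : set X) (cU : clopen U) :
  groupoid_ring cX th := zindic (slice_clopen g cU) (@slice_compact G X th cX g U cU.2).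

Definition groupoid_one : groupoid_ring cX th := slice_indic 1%g clopenT.

Definition groupoid_mul f h : groupoid_ring cX th := ZFun (conv_zfun cX f h).

Fact groupoid_mulA : associative groupoid_mul.
Proof. by move=> f1 f2 f3; apply/val_inj/convA; exact: gsupp_finite. Qed.
Fact groupoid_mul1l : left_id groupoid_one groupoid_mul.
Proof. by move=> f; apply/val_inj/conv1f. Qed.
Fact groupoid_mul1r : right_id groupoid_one groupoid_mul.
Proof. by move=> f; apply/val_inj/convf1. Qed.
Fact groupoid_mulDl : left_distributive groupoid_mul +%R.
Proof. by move=> f1 f2 f3; apply/val_inj/convDl; exact: gsupp_finite. Qed.
Fact groupoid_mulDr : right_distributive groupoid_mul +%R.
Proof. by move=> f1 f2 f3; apply/val_inj/convDr; exact: gsupp_finite. Qed.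

HB.instance Definition _ := GRing.Zmodule_isPzRing.Build (groupoid_ring cX th)
  groupoid_mulA groupoid_mul1l groupoid_mul1r groupoid_mulDl groupoid_mulDr.

End GroupoidRing.

Definition trivial_module (G : groupType) (X : topologicalType)
  (cX : compact [set: X]) (th : partial_action G X) : Type := zfun X.

Section TrivialModule.
Context {G : groupType} {X : topologicalType}.
Variables (cX : compact [set: X]) (th : partial_action G X).
Implicit Types (f h : groupoid_ring cX th) (p : trivial_module cX th).

HB.instance Definition _ := GRing.Zmodule.on (trivial_module cX th).

Definition trivial_scale f p : trivial_module cX th :=
  ZFun (act_triv_zfun cX f (zfun_X_lc p)).

Fact trivial_scaleA f h p :
  trivial_scale f (trivial_scale h p) = trivial_scale (f * h) p.
Proof. by apply/val_inj/act_trivA; exact: gsupp_finite. Qed.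
Fact trivial_scale1 : left_id 1 trivial_scale.
Proof. by move=> p; apply/val_inj/act_triv1. Qed.
Fact trivial_scaleDr : right_distributive trivial_scale +%R.
Proof. by move=> f p q; apply/val_inj/act_trivDr; exact: gsupp_finite. Qed.
Fact trivial_scaleDl p : {morph trivial_scale^~ p : f h / f + h}.
Proof. by move=> f h; apply/val_inj/act_trivDl; exact: gsupp_finite. Qed.

HB.instance Definition _ := GRing.Zmodule_isLmodule.Build
  (groupoid_ring cX th) (trivial_module cX th)
  trivial_scaleA trivial_scale1 trivial_scaleDr trivial_scaleDl.

(* The map r_* from ZG, seen as a left module over itself, to ZX. *)
Definition r_star (f : (groupoid_ring cX th)^o) : trivial_module cX th :=
  ZFun (rng_push_zfun cX f).

End TrivialModule.

Section LeftIdeal.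
Context {R : pzRingType}.

(* The left ideal R e = {y e | y in R}, as a submodule of the regular module. *)
Definition left_ideal_pred (e : R) : {pred R^o} :=
  fun x => `[< exists y : R, x = y * e >].

Fact left_ideal_submod_closed e : submod_closed (left_ideal_pred e).
Proof.
split=> [|a x y /asboolP[x' ->] /asboolP[y' ->]]; apply/asboolP.
  by exists 0; rewrite mul0r.
by exists (a * x' + y'); rewrite mulrDl -mulrA.
Qed.
HB.instance Definition _ e :=
  GRing.isSubmodClosed.Build R R^o (left_ideal_pred e) (left_ideal_submod_closed e).

Record left_ideal (e : R) := LeftIdeal
  { left_ideal_val : R^o; left_ideal_valP : left_ideal_val \in left_ideal_pred e }.

End LeftIdeal.

HB.instance Definition _ (R : pzRingType) (e : R) :=
  [isSub for @left_ideal_val R e].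
HB.instance Definition _ (R : pzRingType) (e : R) :=
  [Choice of left_ideal e by <:].
HB.instance Definition _ (R : pzRingType) (e : R) :=
  [SubChoice_isSubLmodule of left_ideal e by <:].

Section DirectSum.
Context {R : pzRingType} {I : choiceType}.
Variable M : I -> lmodType R.

Record dsum := DSum {
  dsum_val :> forall i, M i;
  _ : `[< finite_set [set i | dsum_val i != 0] >] }.

HB.instance Definition _ := [isSub for dsum_val].
HB.instance Definition _ := [Choice of dsum by <:].

Fact dsum_finite (x : dsum) : finite_set [set i | x i != 0].
Proof. by apply/asboolP; exact: valP x. Qed.

Fact dsum0_subproof : `[< finite_set [set i | (0 : M i) != 0] >].
Proof.
apply/asboolP; rewrite (_ : [set _ | _] = set0); first exact: finite_set0.
by apply/seteqP; split=> i //=; rewrite eqxx.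
Qed.
Definition dsum0 : dsum := DSum dsum0_subproof.

Fact dsumD_subproof (x y : dsum) : `[< finite_set [set i | x i + y i != 0] >].
Proof.
apply/asboolP; apply: (@sub_finite_set _ _ ([set i | x i != 0] `|` [set i | y i != 0])).
  move=> i /=; case: (eqVneq (x i) 0) => [->|]; last by left.
  by rewrite add0r; right.
by rewrite finite_setU; split; exact: dsum_finite.
Qed.
Definition dsumD x y : dsum := DSum (dsumD_subproof x y).

Fact dsumN_subproof (x : dsum) : `[< finite_set [set i | - x i != 0] >].
Proof.
apply/asboolP; apply: sub_finite_set (dsum_finite x) => i /=.
by rewrite oppr_eq0.
Qed.
Definition dsumN x : dsum := DSum (dsumN_subproof x).

Fact dsumZ_subproof a (x : dsum) : `[< finite_set [set i | a *: x i != 0] >].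
Proof.
apply/asboolP; apply: sub_finite_set (dsum_finite x) => i /=.
by apply: contra => /eqP->; rewrite scaler0.
Qed.
Definition dsumZ a x : dsum := DSum (dsumZ_subproof a x).

Fact dsum_eq (x y : dsum) : (forall i, x i = y i) -> x = y.
Proof. by move=> xy; apply/val_inj/functional_extensionality_dep. Qed.

Fact dsumDA : associative dsumD.
Proof. by move=> x y z; apply: dsum_eq => i /=; rewrite addrA. Qed.
Fact dsumDC : commutative dsumD.
Proof. by move=> x y; apply: dsum_eq => i /=; rewrite addrC. Qed.
Fact dsumD0 : left_id dsum0 dsumD.
Proof. by move=> x; apply: dsum_eq => i /=; rewrite add0r. Qed.
Fact dsumDN : left_inverse dsum0 dsumN dsumD.
Proof. by move=> x; apply: dsum_eq => i /=; rewrite addNr. Qed.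
HB.instance Definition _ :=
  GRing.isZmodule.Build dsum dsumDA dsumDC dsumD0 dsumDN.

Fact dsumZA a b x : dsumZ a (dsumZ b x) = dsumZ (a * b) x.
Proof. by apply: dsum_eq => i /=; rewrite scalerA. Qed.
Fact dsumZ1 : left_id 1 dsumZ.
Proof. by move=> x; apply: dsum_eq => i /=; rewrite scale1r. Qed.
Fact dsumZDr : right_distributive dsumZ +%R.
Proof. by move=> a x y; apply: dsum_eq => i /=; rewrite scalerDr. Qed.
Fact dsumZDl x : {morph dsumZ^~ x : a b / a + b}.
Proof. by move=> a b; apply: dsum_eq => i /=; rewrite scalerDl. Qed.
HB.instance Definition _ := GRing.Zmodule_isLmodule.Build R dsum
  dsumZA dsumZ1 dsumZDr dsumZDl.

(* The map out of the direct sum with components phi. *)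
Definition dsum_lift (N : lmodType R) (phi : forall i, M i -> N) (x : dsum) : N :=
  \sum_(i \in [set: I]) phi i (x i).

End DirectSum.

Definition projective (R : pzRingType) (P : lmodType R) : Prop :=
  forall (M N : lmodType R) (q : {linear M -> N}) (f : {linear P -> N}),
    (forall y, exists x, q x = y) ->
    exists h : {linear P -> M}, forall x, q (h x) = f x.

(* 0 -> P1 -d-> P0 -e-> M -> 0 is a projective resolution of M. *)
Definition projective_resolution1 (R : pzRingType) (P1 P0 M : lmodType R)
    (d : P1 -> P0) (e : P0 -> M) : Prop :=
  [/\ linear d /\ linear e,
      projective P1 /\ projective P0,
      injective d,
      range d = [set x | e x = 0] &
      range e = setT].

Section FreeGroupAction.
Context {A : choiceType} {X : topologicalType}.

Definition word_length (w : free_group A) : nat := size (word w).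

(* theta_{uv} = theta_u o theta_v as partial maps, the composite being defined
   on the x in X_{v^-1} with theta_v(x) in X_{u^-1}. *)
Definition semi_saturated (th : partial_action (free_group A) X) : Prop :=
  forall u v : free_group A,
    word_length (u * v)%g = (word_length u + word_length v)%N ->
    forall x,
      (pdom th (u * v)^-1%g x <-> pdom th v^-1%g x /\ pdom th u^-1%g (th v x)) /\
      (pdom th (u * v)^-1%g x -> th (u * v)%g x = th u (th v x)).

Variables (cX : compact [set: X]) (th : partial_action (free_group A) X).

(* 1_{X_a} and delta_a. *)
Definition dom_indic (a : A) : groupoid_ring cX th :=
  slice_indic cX th 1%g (pdom_clopen th (free_gen a)).

Definition delta (a : A) : groupoid_ring cX th :=
  slice_indic cX th (free_gen a) (pdom_clopen th (free_gen a)^-1%g).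

Definition boundary_component (a : A) (f : left_ideal (dom_indic a)) :
  (groupoid_ring cX th)^o := (\val f : groupoid_ring cX th) * delta a - (\val f : groupoid_ring cX th).

Definition boundary :
    dsum (fun a => left_ideal (dom_indic a) : lmodType (groupoid_ring cX th)) ->
    (groupoid_ring cX th)^o :=
  dsum_lift boundary_component.

End FreeGroupAction.

Arguments r_star {G X} cX th f.
Arguments boundary {A X} cX th x.

(* Main.v *)
Require Import Defs.
From HB Require Import structures.
From mathcomp Require Import all_boot all_order all_algebra.
From mathcomp Require Import finmap all_classical topology.

Set Implicit Arguments.
Unset Strict Implicit.
Unset Printing Implicit Defensive.

Import GRing.Theory.

Local Open Scope classical_set_scope.
Local Open Scope ring_scope.

(** Restrict everything to the arrows with a fixed range y, indexed by the
    labels g with y in X_g.  By semi-saturation these labels are closed under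
    prefixes, so they span a subtree T_y of the Cayley tree of F_A.  An element f
    of the a-summand has its coefficient at (g, y) supported on the edges from g
    to ga of T_y, and the fibre of the complex at y is the augmented chain complex
    of the tree T_y.  It is exact at ZG because g - 1 is the boundary of the path
    from 1 to g, and local constancy in y is preserved since every vertex of this
    path lies in T_y whenever g does; the boundary is injective because, at a
    vertex of maximal length, only the edge towards 1 can carry a coefficient.
    The summands are projective since 1_{X_a} is an idempotent. *)

(** * Projectivity of the regular module and of left ideals generated by idempotents *)

Definition linear_pack (R : pzRingType) (U V : lmodType R) (f : U -> V)
    (lf : linear f) : {linear U -> V} :=
  HB.pack f (GRing.isLinear.Build R U V *:%R f lf).

Lemma projective_regular (R : pzRingType) : projective (R^o : lmodType R).
Proof.
move=> M N q f qs; have [x qx] := qs (f 1).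
have lh : linear (fun r : R^o => (r : R) *: x).
  by move=> a u v; rewrite scalerDl scalerA.
exists (linear_pack lh) => r /=.
by rewrite linearZ qx -linearZ /=; congr (f _); rewrite /GRing.scale /= mulr1.
Qed.

(** Every r in Re satisfies r = re, so r |-> r x lifts f as soon as x lifts f(e). *)
Lemma projective_left_ideal (R : pzRingType) (e : R) :
  e * e = e -> projective (left_ideal e).
Proof.
move=> ee M N q f qs.
have ein : (e : R^o) \in left_ideal_pred e by apply/asboolP; exists 1; rewrite mul1r.
have [x qx] := qs (f (LeftIdeal ein)).
have lh : linear (fun r : left_ideal e => (\val r : R) *: x).
  by move=> a u v; rewrite scalerA -scalerDl.
exists (linear_pack lh) => r /=.
rewrite linearZ qx -linearZ /=; congr (f _); apply/val_inj => /=.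
have /asboolP[y ry] := left_ideal_valP r.
by rewrite [LHS](_ : _ = (val r : R) * e) // [val r]ry -mulrA ee.
Qed.

(** * Direct sums of modules *)

Section DirectSumTheory.
Context {R : pzRingType} {I : choiceType} {M : I -> lmodType R}.

Lemma dsum_addE (x y : dsum M) i : (x + y) i = x i + y i. Proof. by []. Qed.
Lemma dsum_scaleE r (x : dsum M) i : (r *: x) i = r *: x i. Proof. by []. Qed.

(** Any finite set containing the support will do, so that elements with different supports can be
    summed over a common index set. *)
Lemma dsum_lift_fset (N : lmodType R) (phi : forall i, {linear M i -> N})
    (D : set I) (x : dsum M) :
  finite_set D -> [set i | x i != 0] `<=` D ->
  dsum_lift (fun i => phi i) x = \sum_(i <- fset_set D) phi i (x i).
Proof.
move=> fD xD; rewrite -fsbig_finite //; apply/esym/fsbig_widen => // i [_ /= Di].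
have [->|xi0] := eqVneq (x i) 0; first by rewrite linear0.
by case: Di; exact: xD.
Qed.

Lemma dsum_lift_linear (N : lmodType R) (phi : forall i, {linear M i -> N}) :
  linear (dsum_lift (fun i => phi i)).
Proof.
move=> r x y; set D := [set i | x i != 0] `|` [set i | y i != 0].
have fD : finite_set D by rewrite finite_setU; split; exact: dsum_finite.
rewrite (dsum_lift_fset _ fD); last first.
  move=> i s0.
  have [x0|] := eqVneq (x i) 0; last by left.
  by right; apply: contraNneq s0 => y0; rewrite dsum_addE dsum_scaleE x0 y0 scaler0 addr0.
rewrite !(dsum_lift_fset _ fD); [|by move=> i; right|by move=> i; left].
rewrite scaler_sumr -big_split; apply: eq_bigr => i _ /=.
by rewrite linearP.
Qed.

(** Since m has type [M i], at an index j it must be transported along a proof of [i = j]. *)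
Lemma dsum_single_subproof i (m : M i) :
  `[< finite_set [set j | (if pselect (i = j) is left e
        then eq_rect i (fun k => M k) m j e else 0) != 0] >].
Proof.
apply/asboolP; apply: (sub_finite_set _ (finite_set1 i)) => j /=.
by case: pselect => //= ij; rewrite eqxx.
Qed.
Definition dsum_single i (m : M i) : dsum M := DSum (dsum_single_subproof m).

Lemma dsum_single_id i (m : M i) : dsum_single m i = m.
Proof.
rewrite /=; case: pselect => // e.
by rewrite (Prop_irrelevance e erefl).
Qed.

Lemma dsum_single_neq i j (m : M i) : i <> j -> dsum_single m j = 0.
Proof. by rewrite /=; case: pselect. Qed.

Lemma dsum_single_linear i : linear (@dsum_single i).
Proof.
move=> r m n; apply: dsum_eq => j; rewrite dsum_addE dsum_scaleE.
have [<-|/eqP ij] := eqVneq i j; first by rewrite !dsum_single_id.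
by rewrite !dsum_single_neq // scaler0 addr0.
Qed.

Lemma dsum_lift_single (N : lmodType R) (phi : forall i, {linear M i -> N})
    i (m : M i) : dsum_lift (fun i => phi i) (dsum_single m) = phi i m.
Proof.
rewrite (dsum_lift_fset _ (finite_set1 i)); last first.
  by move=> j; apply: contra_neqP => ij; rewrite dsum_single_neq // => /esym.
by rewrite fset_set1 big_seq_fset1 dsum_single_id.
Qed.

Lemma dsum_lift_singleE (x : dsum M) :
  dsum_lift (fun i => linear_pack (@dsum_single_linear i)) x = x.
Proof.
rewrite (dsum_lift_fset _ (dsum_finite x)) //; apply: dsum_eq => j.
have -> : (\sum_(i <- fset_set [set i | x i != 0]) dsum_single (x i)) j =
          \sum_(i <- fset_set [set i | x i != 0]) dsum_single (x i) j.
  by elim/big_rec2: _ => // i u v _ <-.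
have [x0|xj] := eqVneq (x j) 0.
  rewrite x0 big1_seq // => i _; have [->|/eqP ij] := eqVneq i j.
    by rewrite dsum_single_id.
  by rewrite dsum_single_neq.
rewrite (big_fsetD1 j); last by rewrite in_fset_set ?mem_setE //; exact: dsum_finite.
rewrite dsum_single_id big1_seq; first exact: addr0.
by move=> i /andP[_]; rewrite !inE => /andP[/eqP ij _]; exact: dsum_single_neq.
Qed.

(** Lift f on each summand and add up the lifts; the sum lifts f because every element is the sum of
    its components. *)
Lemma projective_dsum : (forall i, projective (M i)) -> projective (dsum M).
Proof.
move=> pM P N q f qs.
have H i : exists h : {linear M i -> P}, forall m, q (h m) = f (dsum_single m).
  by have [h hE] := pM i P N q (f \o linear_pack (@dsum_single_linear i)) qs; exists h.
pose h i := projT1 (cid (H i)).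
have hE i m : q (h i m) = f (dsum_single m) by rewrite /h; case: cid.
exists (linear_pack (dsum_lift_linear h)) => x /=.
rewrite -[in RHS](dsum_lift_singleE x) !(dsum_lift_fset _ (dsum_finite x)) //.
by rewrite !linear_sum; apply: eq_bigr => i _; rewrite hE.
Qed.

End DirectSumTheory.

(** * Word length in the free group *)

Section FreeGroupLength.
Context {A : choiceType}.
Implicit Types (x : A * bool) (u k : free_group A).

Definition fg_letter x : free_group A := @FreeGroup A [:: x] isT.

Lemma fg_letterV x : (fg_letter x)^-1%g = fg_letter (letter_inv x).
Proof. exact/val_inj. Qed.

Lemma free_genV a : (free_gen a)^-1%g = fg_letter (a, false).
Proof. exact/val_inj. Qed.

Lemma word_lengthV u : word_length u^-1%g = word_length u.
Proof. by rewrite /word_length [word _](_ : _ = word_inv (word u)) // size_rev size_map. Qed.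

Lemma word_length0 u : word_length u = 0%N -> u = 1%g.
Proof. by move=> /size0nil u0; apply/val_inj. Qed.

(* [ohead (word k^-1)] is the inverse of the last letter of k, i.e. the unique
   letter shortening k by right multiplication. *)
Lemma word_length_mul_letter k x : word_length (k * fg_letter x)%g =
  if ohead (word k^-1%g) == Some x then (word_length k).-1 else (word_length k).+1.
Proof.
(* Inverting turns right multiplication by a letter into left multiplication, which acts on reduced
   words by [cons_reduce]. *)
rewrite -word_lengthV invgM fg_letterV -(word_lengthV k) /word_length.
rewrite [word (_ * _)%g](_ : _ = cons_reduce (letter_inv x) (word k^-1%g)) //.
case: (word k^-1%g) => [|y s] //=; rewrite letter_invK.
by have [->|yx] := eqVneq y x; rewrite ?eqxx //; case: eqP => // -[] /eqP; rewrite (negbTE yx).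
Qed.

Lemma word_length_shorten k : word_length k != 0%N ->
  exists x, word_length k = (word_length (k * fg_letter x)%g).+1.
Proof.
rewrite -(word_lengthV k); case E: (word k^-1%g) => [|x s]; first by rewrite /word_length E.
exists x; rewrite word_length_mul_letter E eqxx -(word_lengthV k).
by rewrite /word_length E.
Qed.

End FreeGroupLength.

(** * Prefix closure of the labels at a point *)

Section Prefix.
Context {A : choiceType} {X : topologicalType}.
Variable th : partial_action (free_group A) X.

(** Semi-saturation is applied at the source z of the arrow with label uv and range y. It factors y
    as theta_u(theta_v(z)), which puts y in the image of theta_u and identifies theta_{u^-1}(y) with
    theta_v(z). *)
Lemma semi_saturated_prefix u v y : semi_saturated th ->
  word_length (u * v)%g = (word_length u + word_length v)%N ->
  pdom th (u * v)%g y ->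
  [/\ pdom th u y, pdom th v^-1%g (th (u * v)^-1%g y) & pdom th v (th u^-1%g y)].
Proof.
move=> ss uv dy; have [dE aE] := ss u v uv (th (u * v)^-1%g y).
have dz := pactV_dom dy; have [vz uvz] := dE.1 dz.
have yE : y = th u (th v (th (u * v)^-1%g y)) by rewrite -aE // pactVK.
split=> //; first by rewrite yE; exact: pact_dom.
by rewrite [in X in th _ X]yE pactK //; exact: pact_dom.
Qed.

End Prefix.

(** * Elements of the groupoid ring through their coefficients at a label and a range *)

Section Coefficients.
Context {G : groupType} {X : topologicalType}.
Variables (cX : compact [set: X]) (th : partial_action G X).
Local Notation ZG := (groupoid_ring cX th).
Implicit Types (f : ZG) (g h k : G) (y z : X).

Lemma zfun_coef_ext f f' : (forall g y, coef f g y = coef f' g y) -> f = f'.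
Proof. by move=> ff'; apply/val_inj/coef_ext. Qed.

Lemma coef_zfun0 g y : coef (0 : ZG) g y = 0.
Proof. by rewrite /coef; case: pselect. Qed.

Lemma coef_zfun_sum (I : Type) (r : seq I) (F : I -> ZG) g y :
  coef (\sum_(i <- r) F i) g y = \sum_(i <- r) coef (F i) g y.
Proof.
elim: r => [|i r IHr]; first by rewrite !big_nil coef_zfun0.
by rewrite !big_cons -IHr; exact: Defs.coefD.
Qed.

Lemma coef_slice_indic g (U : set X) (cU : clopen U) h z :
  coef (slice_indic cX th g cU) h z =
  ((h == g) && `[< pdom th g z /\ U (th g^-1%g z) >])%:R.
Proof.
rewrite /coef; case: pselect => [hz|hz].
  congr ((_ : bool)%:R); apply/idP/andP => [/set_mem[/= hg Uz]|[/eqP hg /asboolP[gz Uz]]].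
    by split; [exact/eqP | apply/asboolP; rewrite -[g]hg].
  by apply/mem_set; split=> //=; rewrite /src /= hg.
by have [hg|//] := eqVneq h g; rewrite asboolF // -hg => -[].
Qed.

(** The slice carries the single label g, so only the term with label k g^-1 survives in the
    convolution. *)
Lemma coef_mul_slice f g (U : set X) (cU : clopen U) k y :
  coef (f * slice_indic cX th g cU) k y = coef f (k * g^-1)%g y *
  `[< pdom th g (th (k * g^-1)^-1%g y) /\ U (th g^-1%g (th (k * g^-1)^-1%g y)) >]%:R.
Proof.
rewrite [LHS]coef_conv -(fsbig_widen [set (k * g^-1)%g]) //; last first.
  move=> h [_ /= hk]; rewrite (coef_slice_indic _ cU).
  have [E|] := eqVneq (h^-1 * k)%g g; last by rewrite mulr0.
  by case: hk; rewrite -E invgM invgK mulVKg.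
by rewrite fsbig_set1 (coef_slice_indic _ cU) invgM invgK mulgVK eqxx.
Qed.

(** Supplies the elements supported on one label, from which preimages under [boundary] and [r_star]
    are built. *)
Lemma exists_coef_mono (p : X -> int) g : locally_constant p ->
  (forall y, p y != 0 -> pdom th g y) ->
  exists f, forall k y, coef f k y = if k == g then p y else 0.
Proof.
move=> pl pg; pose f (c : arrow th) := if lab c == g then p (rng c) else 0.
have fE k y : coef f k y = if k == g then p y else 0.
  rewrite /coef; case: pselect => [ky|ky]; first by rewrite /f rng_arrow_at.
  by case: eqP => // kg; apply/esym/eqP; apply: contra_notT ky; rewrite kg; exact: pg.
suff fin : f \in @zfun_pred (arrow th) by exists (ZFun fin).
apply: (zfun_arrowP cX) => [k|].
  rewrite (_ : coef f k = fun y => if k == g then p y else 0); last exact/funext.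
  by case: (k == g) => // y; exact: nearW.
apply: (sub_finite_set _ (finite_set1 g)) => k [y]; rewrite fE.
by have [->|] := eqVneq k g; last rewrite eqxx.
Qed.

Lemma r_star_linear : linear (r_star cX th).
Proof.
(* The map r_* sends f to f acting on the constant function 1, so its linearity follows from the
   module axioms. *)
have l1 : locally_constant (fun _ : X => 1 : int) by move=> x; apply: nearW.
pose u : trivial_module cX th := ZFun (zfun_XP cX l1).
have rE f : r_star cX th f = f *: u.
  by apply/val_inj/funext => x; rewrite /= rng_pushE act_trivE.
by move=> a f f'; rewrite !rE scalerDl scalerA.
Qed.

End Coefficients.

(** * The boundary map in coefficients *)

Section Boundary.
Context {A : choiceType} {X : topologicalType}.
Variables (cX : compact [set: X]) (th : partial_action (free_group A) X).
Local Notation ZG := (groupoid_ring cX th).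
Local Notation P1 := (dsum (fun a => left_ideal (dom_indic cX th a) : lmodType ZG)).

Lemma coef_mul_dom_indic (f : ZG) a k y : coef (f * dom_indic cX th a) k y =
  coef f k y * `[< pdom th (free_gen a) (th k^-1%g y) >]%:R.
Proof.
rewrite coef_mul_slice !invg1 mulg1 pact1; congr (_ * (_ : bool)%:R).
by apply/asbool_equiv_eq; rewrite pdom1; split=> [[]|].
Qed.

(** Right multiplication by 1_{X_a} restricts a function to the arrows with source in X_a, hence
    fixes exactly those already supported there. *)
Lemma left_ideal_dom_indicP a (f : ZG) :
  reflect (forall k y, coef f k y != 0 -> pdom th (free_gen a) (th k^-1%g y))
    ((f : ZG^o) \in left_ideal_pred (dom_indic cX th a)).
Proof.
apply: (iffP idP) => [/asboolP[h ->] k y|H].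
  rewrite coef_mul_dom_indic; apply: contraPP => nd.
  by rewrite (asboolF nd) mulr0 eqxx.
apply/asboolP; exists f; apply: zfun_coef_ext => k y; rewrite coef_mul_dom_indic.
have [->|/H ad] := eqVneq (coef f k y) 0; first by rewrite mul0r.
by rewrite asboolT // mulr1.
Qed.

Lemma dom_indic_idem a : dom_indic cX th a * dom_indic cX th a = dom_indic cX th a.
Proof.
apply: zfun_coef_ext => k y; rewrite coef_mul_dom_indic.
have := @left_ideal_dom_indicP a (dom_indic cX th a).
case: asboolP => [|nd]; rewrite ?mulr1 // mulr0 => H.
apply/esym/eqP; apply: contra_notT nd; move: k y; apply/H.
by apply/asboolP; exists 1; rewrite mul1r.
Qed.

(** The support condition on the ideal makes the cut-off in [coef_mul_slice] automatic, so [delta]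
    acts by translation of labels alone. *)
Lemma coef_left_ideal_delta a (f : left_ideal (dom_indic cX th a)) k y :
  coef ((val f : ZG) * delta cX th a) k y =
  coef (val f : ZG) (k * (free_gen a)^-1)%g y.
Proof.
rewrite coef_mul_slice.
have [->|ne] := eqVneq (coef (val f : ZG) (k * (free_gen a)^-1)%g y) 0.
  by rewrite mul0r.
have ad := left_ideal_dom_indicP a _ (left_ideal_valP f) _ _ ne.
by rewrite asboolT ?mulr1 //; split=> //; exact: pactV_dom.
Qed.

(** In the tree at y, the first term is the a-edge arriving at k and the second the a-edge leaving
    k. *)
Lemma coef_boundary_component a (f : left_ideal (dom_indic cX th a)) k y :
  coef (boundary_component f : ZG) k y =
  coef (val f : ZG) (k * (free_gen a)^-1)%g y - coef (val f : ZG) k y.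
Proof. by rewrite -coef_left_ideal_delta -Defs.coefB. Qed.

Lemma boundary_component_linear a : linear (@boundary_component A X cX th a).
Proof.
move=> r f f'; rewrite /boundary_component /=.
rewrite [LHS](_ : _ = (r * val f + val f') * delta cX th a - (r * val f + val f')) //.
by rewrite [RHS](_ : _ = r * (val f * delta cX th a - val f) + (val f' * delta cX th a - val f')) //
  mulrDl mulrBr mulrA opprD addrACA.
Qed.

Lemma boundary_linear : linear (boundary cX th).
Proof. exact: (dsum_lift_linear (fun a => linear_pack (@boundary_component_linear a))). Qed.

Lemma coef_boundary (x : P1) k y :
  coef (boundary cX th x : ZG) k y =
  \sum_(a <- fset_set [set a | x a != 0])
    (coef (val (x a) : ZG) (k * (free_gen a)^-1)%g y - coef (val (x a) : ZG) k y).
Proof.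
rewrite /boundary.
rewrite (dsum_lift_fset (fun a => linear_pack (@boundary_component_linear a)) (dsum_finite x)) //.
by rewrite coef_zfun_sum; apply: eq_bigr => a _; rewrite coef_boundary_component.
Qed.

End Boundary.

(** * Exactness of the complex *)

Section Exactness.
Context {A : choiceType} {X : topologicalType}.
Variables (cX : compact [set: X]) (th : partial_action (free_group A) X).
Local Notation ZG := (groupoid_ring cX th).
Local Notation ideals := (fun a => left_ideal (dom_indic cX th a) : lmodType ZG).
Local Notation P1 := (dsum ideals).

Lemma word_length_bounded (D : set (free_group A)) : finite_set D ->
  exists n, forall k, D k -> (word_length k <= n)%N.
Proof.
move=> fD; exists (\max_(k <- fset_set D) word_length k) => k Dk.
by apply: leq_bigmax_seq => //; rewrite in_fset_set //; exact/mem_set.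
Qed.

(** Starting point for the descent on length: finitely many components, each with finitely many
    labels. *)
Lemma dsum_word_length_bounded (x : P1) : exists n, forall a k y,
  coef (val (x a) : ZG) k y != 0 -> (word_length k <= n)%N.
Proof.
pose D := \bigcup_(a in [set a | x a != 0]) gsupp (val (x a) : ZG).
have fD : finite_set D.
  apply: bigcup_finite; first exact: dsum_finite.
  by move=> a _; exact: gsupp_finite.
have [n nD] := word_length_bounded fD; exists n => a k y xk.
apply: nD; exists a; last by exists y.
by apply: contraNneq xk => ->; rewrite coef_zfun0.
Qed.

(* At a vertex k of maximal length only the edge towards the origin can carry
   a nonzero coefficient, and the boundary at k is then plus or minus it. *)
Lemma boundary_eq0_descent (x : P1) n : boundary cX th x = 0 ->
  (forall a k y, (n.+1 < word_length k)%N ->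
    coef (val (x a) : ZG) (k * (free_gen a)^-1)%g y = 0 /\
    coef (val (x a) : ZG) k y = 0) ->
  forall a k y, (n < word_length k)%N ->
    coef (val (x a) : ZG) (k * (free_gen a)^-1)%g y = 0 /\
    coef (val (x a) : ZG) k y = 0.
Proof.
(* [F b c] is the coefficient on the edge joining k to its product with the letter (b, c): outgoing
   for a generator, incoming for an inverse. *)
move=> bx IH a k y nk; pose F b c := if c then coef (val (x b) : ZG) k y
  else coef (val (x b) : ZG) (k * (free_gen b)^-1)%g y.
suff F0 : forall b c, F b c = 0 by split; [exact: (F0 a false) | exact: (F0 a true)].
(* A letter that does not shorten k leads to a longer vertex, where all edges vanish by
   hypothesis. *)
have Fout b c : ohead (word k^-1%g) != Some (b, c) -> F b c = 0.
  move=> kb; have := word_length_mul_letter k (b, c); rewrite (negbTE kb) => wk.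
  case: c kb wk => kb wk.
    have [] := IH b (k * free_gen b)%g y; first by rewrite wk ltnS.
    by rewrite mulgK.
  have [] := IH b (k * (free_gen b)^-1)%g y; first by rewrite free_genV wk ltnS.
  by [].
move=> b c; have [kbc|/Fout //] := eqVneq (ohead (word k^-1%g)) (Some (b, c)).
apply/eqP; apply: contraT => Fbc.
have xb : x b != 0.
  by apply: contraNneq Fbc => xb; rewrite /F xb !coef_zfun0 if_same.
have : coef (boundary cX th x : ZG) k y = 0 by rewrite bx coef_zfun0.
rewrite coef_boundary (big_fsetD1 b) /=; last first.
  by rewrite in_fset_set ?mem_setE //; exact: dsum_finite.
rewrite big1_seq; last first.
  move=> d /andP[_]; rewrite !inE => /andP[/eqP db _].
  have Fd e : F d e = 0 by apply: Fout; rewrite kbc; apply/eqP => -[/esym].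
  by rewrite [LHS](_ : _ = F d false - F d true) // !Fd subrr.
rewrite addr0 [LHS](_ : _ = F b false - F b true) //.
have : F b (~~ c) = 0 by apply: Fout; rewrite kbc; apply/eqP => -[]; case: c {kbc Fbc}.
case: c {kbc} Fbc => Fbc -> /eqP; first by rewrite sub0r oppr_eq0 (negbTE Fbc).
by rewrite subr0 (negbTE Fbc).
Qed.

Lemma boundary_injective : injective (boundary cX th).
Proof.
suff b0 (x : P1) : boundary cX th x = 0 -> x = 0.
  move=> x y bxy; apply/eqP; rewrite -subr_eq0; apply/eqP/b0.
  pose bl := linear_pack (@boundary_linear _ _ cX th).
  by rewrite -[LHS]/(bl (x - y)) raddfB /= bxy subrr.
move=> bx; have [N xN] := dsum_word_length_bounded x.
pose Q n := forall a k y, (n < word_length k)%N ->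
    coef (val (x a) : ZG) (k * (free_gen a)^-1)%g y = 0 /\
    coef (val (x a) : ZG) k y = 0.
(* Labels carrying a coefficient have length at most N, but an edge may end one step further out,
   hence [N.+1]. *)
have QN : Q N.+1.
  move=> a k y kN; split; apply/eqP; apply: contraTT kN => /xN; rewrite -leqNgt => kN.
    have := word_length_mul_letter (k * (free_gen a)^-1)%g (a, true).
    rewrite [fg_letter _](_ : _ = free_gen a) // mulgVK => ->.
    by case: ifP => // _; exact: leq_trans (leq_pred _) (leq_trans kN (leqnSn _)).
  exact: leq_trans kN (leqnSn _).
have Q0 : Q 0%N.
  elim: N.+1 QN => // n IHn Qn; apply: IHn; exact: boundary_eq0_descent.
apply: dsum_eq => a; apply/val_inj/zfun_coef_ext => k y.
rewrite [RHS]coef_zfun0; have [/word_length0 ->|] := eqVneq (word_length k) 0%N.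
  (* [Q 0] says nothing at the vertex 1, so the edge from 1 to a is read off at its other end a. *)
  by have [|+ _] := Q0 a (free_gen a) y; rewrite ?mulgV.
by rewrite -lt0n => /(Q0 a k y)[].
Qed.

Lemma coef_boundary_single a (f : left_ideal (dom_indic cX th a)) k y :
  coef (boundary cX th (dsum_single (M := ideals) f : P1) : ZG) k y =
  coef (val f : ZG) (k * (free_gen a)^-1)%g y - coef (val f : ZG) k y.
Proof.
rewrite -coef_boundary_component /boundary.
by rewrite (dsum_lift_single (fun a => linear_pack (@boundary_component_linear _ _ cX th a))).
Qed.

Lemma coef_boundaryD (u v : P1) k y : coef (boundary cX th (u + v) : ZG) k y =
  coef (boundary cX th u : ZG) k y + coef (boundary cX th v : ZG) k y.
Proof.
pose bl := linear_pack (@boundary_linear _ _ cX th).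
by rewrite -Defs.coefD -[boundary _ _ _]/(bl (u + v)) raddfD.
Qed.

Lemma coef_boundaryB (u v : P1) k y : coef (boundary cX th (u - v) : ZG) k y =
  coef (boundary cX th u : ZG) k y - coef (boundary cX th v : ZG) k y.
Proof.
pose bl := linear_pack (@boundary_linear _ _ cX th).
by rewrite -Defs.coefB -[boundary _ _ _]/(bl (u - v)) raddfB.
Qed.

(* The difference g - 1 is the boundary of the path from 1 to g. *)
Lemma boundary_path (p : X -> int) g : semi_saturated th -> locally_constant p ->
  (forall y, p y != 0 -> pdom th g y) ->
  exists x : P1, forall k y, coef (boundary cX th x : ZG) k y =
    (if k == g then p y else 0) - (if k == 1%g then p y else 0).
Proof.
move=> ss pl; move En: (word_length g) => n.
elim: n g En => [|n IHn] g gn pg.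
  exists 0 => k y; rewrite (word_length0 gn) subrr.
  pose bl := linear_pack (@boundary_linear _ _ cX th).
  by rewrite -[boundary _ _ _]/(bl 0) raddf0 coef_zfun0.
have [|[a b] gE] := @word_length_shorten A g; first by rewrite gn.
(* The vertex h precedes g on the path from 1; prefix closure will put h and the edge between them
   in the tree wherever p is nonzero. *)
set h := (g * fg_letter (a, b))%g in gE.
have gh : g = (h * (fg_letter (a, b))^-1)%g by rewrite /h mulgK.
have ph y : p y != 0 -> [/\ pdom th h y,
    pdom th (fg_letter (a, b)) (th g^-1%g y) &
    pdom th (fg_letter (a, b))^-1%g (th h^-1%g y)].
  move=> /pg; rewrite gh => /(semi_saturated_prefix ss) H.
  have {H}[|? ? ?] := H; first by rewrite -gh gE fg_letterV addn1.
  by split=> //; rewrite -[X in pdom _ X]invgK.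
have [x xE] := IHn h (eq_add_S _ _ (etrans (esym gE) gn)) (fun y py => let: And3 d _ _ := ph y py in d).
(* The last edge is labelled by the vertex it leaves. If h = ga it runs from g to h, so p at label g
   is subtracted; if g = ha it runs from h to g, so p at label h is added. *)
case: b => [|] in h gE gh ph x xE *.
- have [m mE] := exists_coef_mono cX pl pg.
  have mI : (m : ZG^o) \in left_ideal_pred (dom_indic cX th a).
    apply/left_ideal_dom_indicP => k y; rewrite mE.
    by have [->|] := eqVneq k g; [move=> /ph[] | rewrite eqxx].
  exists (x - dsum_single (M := ideals) (LeftIdeal mI)) => k y.
  rewrite coef_boundaryB coef_boundary_single xE /= !mE.
  have -> : (k * (free_gen a)^-1 == g)%g = (k == h) by rewrite gh (inj_eq (mulIg _)).
  by rewrite opprB addrC addrA subrK.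
- have [m mE] := exists_coef_mono cX pl (fun y py => let: And3 d _ _ := ph y py in d).
  have mI : (m : ZG^o) \in left_ideal_pred (dom_indic cX th a).
    apply/left_ideal_dom_indicP => k y; rewrite mE.
    have [->|] := eqVneq k h; [move=> /ph[_ _] | by rewrite eqxx].
    by rewrite fg_letterV.
  exists (x + dsum_single (M := ideals) (LeftIdeal mI)) => k y.
  rewrite coef_boundaryD coef_boundary_single xE /= !mE.
  have -> : (k * (free_gen a)^-1 == h)%g = (k == g).
    by rewrite free_genV (inj_eq (mulIg _)).
  by rewrite addrC addrA subrK.
Qed.

(** On each summand, f times [delta] and f have the same sum over labels, by the reindexing k |-> k
    a^-1. *)
Lemma r_star_boundary (x : P1) : r_star cX th (boundary cX th x) = 0.
Proof.
pose rl := linear_pack (@r_star_linear _ _ cX th).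
rewrite /boundary.
rewrite (dsum_lift_fset (fun a => linear_pack (@boundary_component_linear _ _ cX th a)) (dsum_finite x)) //.
rewrite -[LHS]/(rl _) linear_sum big1 // => a _ /=; rewrite /boundary_component.
rewrite -[LHS]/(rl (_ - _)) raddfB /=; apply/eqP; rewrite subr_eq0; apply/eqP.
apply/val_inj/funext => y; rewrite /= !rng_pushE.
rewrite [RHS](reindex_fsbigT (fun k => k * (free_gen a)^-1)%g); last first.
  by exists (fun k => k * free_gen a)%g => k; rewrite ?mulgK ?mulgVK.
by apply: eq_fsbigr => k _; rewrite -coef_left_ideal_delta.
Qed.

Lemma r_star_surjective : range (r_star cX th) = setT.
Proof.
apply/seteqP; split=> // p _.
have [|f fE] := @exists_coef_mono _ _ cX th p 1%g (zfun_X_lc p); first by move=> y; rewrite pdom1.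
exists f => //; apply/val_inj/funext => y; rewrite /= rng_pushE.
rewrite -(fsbig_widen [set 1%g]) //; last first.
  by move=> k [_ /= /eqP k1]; rewrite fE (negbTE k1) mul0r.
by rewrite fsbig_set1 fE eqxx mulr1.
Qed.

(** Where the coefficients f_g sum to 0, the sum of the f_g g equals that of the f_g (g - 1), and
    each of these terms is a boundary by [boundary_path]. *)
Lemma range_boundary : semi_saturated th ->
  range (boundary cX th) = [set f | r_star cX th f = 0].
Proof.
move=> ss; apply/seteqP; split=> [_ [x _ <-]|f /= rf0]; first exact: r_star_boundary.
have H g := @boundary_path (coef f g) g ss (zfun_coef_lc f g) (fun y => @coef_neq0 _ _ _ f g y).
have [x xE] := choice H.
exists (\sum_(g <- fset_set (gsupp f)) x g) => //.
apply: zfun_coef_ext => k y.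
pose bl := linear_pack (@boundary_linear _ _ cX th).
rewrite -[boundary _ _ _]/(bl _) linear_sum /= coef_zfun_sum.
under eq_bigr => g _ do rewrite xE.
have ff := gsupp_finite f.
(* The contributions at the vertex 1 add up to r_*(f)(y), which vanishes. *)
rewrite sumrB [X in _ - X](_ : _ = 0) ?subr0; last first.
  have [k1|_] := eqVneq k 1%g; last by rewrite big1.
  transitivity (rng_push f y); last by rewrite -[LHS]/(r_star cX th f y) rf0.
  rewrite rng_pushE (gsum_finite _ _ ff) //.
  by apply: eq_bigr => g _; rewrite mulr1.
have [fk|fk] := pselect (gsupp f k); last first.
  rewrite (coef0_gsupp y fk) big1_seq // => g /andP[_].
  rewrite in_fset_set // => /set_mem fg; have [kg|//] := eqVneq k g.
  by case: fk; rewrite kg.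
rewrite (big_fsetD1 k) /=; last by rewrite in_fset_set //; exact/mem_set.
rewrite eqxx big1_seq ?addr0 // => g /andP[_]; rewrite !inE => /andP[gk _].
by rewrite eq_sym (negbTE gk).
Qed.

End Exactness.

Theorem theoremA (A : choiceType) (X : topologicalType)
    (cX : compact [set: X]) (hX : hausdorff_space X)
    (tdX : totally_disconnected [set: X])
    (th : partial_action (free_group A) X) (ssth : semi_saturated th) :
  projective_resolution1 (boundary cX th) (r_star cX th).
Proof.
split.
- by split; [exact: boundary_linear | exact: r_star_linear].
- split; last exact: projective_regular.
  by apply: projective_dsum => a; apply: projective_left_ideal; exact: dom_indic_idem.
- exact: boundary_injective.
- exact: range_boundary.
- exact: r_star_surjective.
Qed.
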